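(* Let $A,B,C,X_1,X_2,X_3\in\mathbb{T}^2$ be any tropical points and $l$ any tropical line. Perform the following construction, where $\overline{UV}$ denotes the stable tropical line through $U,V$ and $\cap$ denotes the stable intersection point of two tropical lines: lines $L_{AB'}=\overline{AX_1}$, $L_{BC'}=\overline{BX_2}$, $L_{CA'}=\overline{CX_3}$; points $P=L_{AB'}\cap l$, $Q=L_{BC'}\cap l$, $R=L_{CA'}\cap l$; lines $L_{AC'}=\overline{AR}$, $L_{BA'}=\overline{BP}$, $L_{CB'}=\overline{CQ}$; points $A'=L_{CA'}\cap L_{BA'}$, $B'=L_{AB'}\cap L_{CB'}$, $C'=L_{AC'}\cap L_{BC'}$. Then there is a tropical conic containing the points $A,B,C,A',B',C'$.
   Context: $\mathbb{T}$, with $\mathbb{Q}\subseteq\mathbb{T}\subseteq\mathbb{R}$, is the value group of an algebraically closed field with a non-trivial rank one valuation (so a divisible subgroup of $\mathbb{R}$), with tropical operations $\max$ and $+$. A tropical curve with support $I\subset\mathbb{Z}^2$ is the set of $(x,y)\in\mathbb{T}^2$ at which $\max_{(i,j)\in I}(a_{ij}+ix+jy)$ is attained at least twice, for some coefficients $a_{ij}\in\mathbb{T}$. A tropical line has support $\{(0,0),(1,0),(0,1)\}$, written $\max(\lambda+x,\mu+y,\nu)$; a tropical conic has support $\{(i,j):i,j\ge0,\ i+j\le2\}$. The stable tropical line through (possibly equal) points $q=(q^1,q^2)$ and $r=(r^1,r^2)$ is given by tropical Cramer's rule: $\lambda=\max(q^2,r^2)$, $\mu=\max(q^1,r^1)$,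 $\nu=\max(q^1+r^2,q^2+r^1)$. The stable intersection point of the (possibly equal) lines with coefficients $(\lambda,\mu,\nu)$, $(\lambda',\mu',\nu')$ is $\bigl(\max(\mu+\nu',\mu'+\nu)-\max(\lambda+\mu',\lambda'+\mu),\ \max(\lambda+\nu',\lambda'+\nu)-\max(\lambda+\mu',\lambda'+\mu)\bigr)$; it is the point that varies continuously with the coefficients and coincides with the intersection point for transversal lines. *)

(* Defs.v *)
From mathcomp Require Import all_boot all_order all_algebra.
From mathcomp Require Import boolp classical_sets reals constructive_ereal.

Set Implicit Arguments.
Unset Strict Implicit.
Unset Printing Implicit Defensive.

Import Order.TTheory GRing.Theory Num.Theory.
Local Open Scope classical_set_scope.
Local Open Scope ring_scope.

(* Rank one means that the values of nonzero elements are real numbers;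
   [valuation_nontrivial] excludes the valuation that vanishes on K^*. *)
Record rank_one_valuation (R : realType) (K : fieldType) (v : K -> \bar R)
    : Prop := RankOneValuation {
  valuation_pinfty : forall x, v x = +oo%E <-> x = 0;
  valuation_ninfty : forall x, v x <> -oo%E;
  valuationM : forall x y, v (x * y) = (v x + v y)%E;
  valuationD : forall x y, (Order.min (v x) (v y) <= v (x + y)%R)%E;
  valuation_nontrivial : exists2 x : K, x != 0 & v x <> 0%E }.

Definition value_group (R : realType) (K : fieldType) (v : K -> \bar R)
    : set R :=
  [set t | exists x, v x = t%:E].

Section TropicalPlane.
Variable R : realType.
Implicit Types (T : set R) (I : set (int * int)) (q r : R * R).

(* The family of coefficients a_ij of a tropical polynomial in two variables;
   only its values on the support under consideration are meaningful. *)
Definition coeffs := int * int -> R.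
Implicit Types a b : coeffs.

Definition coeffs_in T I a := forall ij, I ij -> T (a ij).

Definition tropical_term a (ij : int * int) q : R :=
  a ij + q.1 *~ ij.1 + q.2 *~ ij.2.

Definition tropical_curve T I a : set (R * R) :=
  [set q | (T `*` T) q /\
    exists ij kl, [/\ I ij, I kl, ij <> kl,
      tropical_term a ij q = tropical_term a kl q &
      forall mn, I mn -> tropical_term a mn q <= tropical_term a ij q]].

Definition line_support : set (int * int) := [set` [:: (0, 0); (1, 0); (0, 1)]].

Definition conic_support : set (int * int) :=
  [set ij | [/\ 0 <= ij.1, 0 <= ij.2 & ij.1 + ij.2 <= 2]].

Definition tropical_line_coeffs T a := coeffs_in T line_support a.

Definition is_tropical_conic T (D : set (R * R)) :=
  exists2 a, coeffs_in T conic_support a & D = tropical_curve T conic_support a.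

(* max(lam + x, mu + y, nu) *)
Definition line_coeffs (lam mu nu : R) : coeffs :=
  fun ij => if ij == (1, 0) then lam else if ij == (0, 1) then mu else nu.

Definition stable_line q r : coeffs :=
  line_coeffs (Num.max q.2 r.2) (Num.max q.1 r.1)
              (Num.max (q.1 + r.2) (q.2 + r.1)).

Definition stable_intersection a b : R * R :=
  let lam := a (1, 0) in let mu := a (0, 1) in let nu := a (0, 0) in
  let lam' := b (1, 0) in let mu' := b (0, 1) in let nu' := b (0, 0) in
  (Num.max (mu + nu') (mu' + nu) - Num.max (lam + mu') (lam' + mu),
   Num.max (lam + nu') (lam' + nu) - Num.max (lam + mu') (lam' + mu)).

End TropicalPlane.

(* Main.v *)
(* Lift the seven inputs (six points and a line) to vectors of independent
   indeterminates over the integers, the indeterminates being weighted by the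
   tropical coordinates. The maximal weight of the monomials of a polynomial is
   a valuation. Each input enters the construction of each of A', B', C' only
   once, so no monomials cancel in the cross products involved and the
   valuations of the lifted points are given by tropical Cramer's rule. The
   lifted points lie on an explicit conic: if L_1, L_2, L_3 are the lines AX_1,
   BX_2, CX_3 and M_1, M_2, M_3 the lines BP, CQ, AR, then M_i = p_i L_i - q_i l
   for scalars p_i, q_i, and the conic is
     (p_1 p_2 p_3 L_1 L_2 L_3 - M_1 M_2 M_3) / l.
   The valuations of its coefficients are the coefficients of a tropical conic
   through the given points, since the maximum of the valuations of terms with
   zero sum is attained at least twice. *)
Require Import Defs.
From mathcomp Require Import all_boot all_order all_algebra.
From mathcomp Require Import boolp ring lra.
From mathcomp Require mpoly.

Set Implicit Arguments.
Unset Strict Implicit.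
Unset Printing Implicit Defensive.

Import Order.TTheory GRing.Theory Num.Theory.
Local Open Scope ring_scope.

(** * Weighted degrees of multivariate polynomials *)

Lemma exists_seq_max (J : eqType) (R : realDomainType) (f : J -> R)
    (s : seq J) :
  s != [::] -> exists2 i, i \in s & forall j, j \in s -> f j <= f i.
Proof.
elim: s => // j [|j' s] IH _.
  by exists j => [|x]; rewrite inE // => /eqP ->.
have [//|k ks kM] := IH.
have [le|/ltW le] := leP (f j) (f k).
  exists k => [|x]; first by rewrite inE ks orbT.
  by rewrite inE => /orP[/eqP -> //|/kM].
exists j => [|x]; first by rewrite inE eqxx.
by rewrite inE => /orP[/eqP -> //|/kM /le_trans]; apply.
Qed.

Section WeightedDegree.
Import mpoly.
Variable n : nat.

Definition wtmnm (V : zmodType) (w : 'I_n -> V) (m : 'X_{1..n}) : V :=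
  \sum_i w i *+ m i.

Lemma wtmnmD (V : zmodType) (w : 'I_n -> V) m1 m2 :
  wtmnm w (m1 + m2)%MM = wtmnm w m1 + wtmnm w m2.
Proof.
by rewrite -big_split; apply: eq_bigr => i _; rewrite mnmDE mulrnDr.
Qed.

Lemma wtmnm0 (V : zmodType) (w : 'I_n -> V) : wtmnm w 0%MM = 0.
Proof. by apply: big1 => i _; rewrite mnm0E. Qed.

Lemma wtmnm1 (V : zmodType) (w : 'I_n -> V) i : wtmnm w U_(i)%MM = w i.
Proof.
rewrite /wtmnm (bigD1 i) //= mnm1E eqxx big1 ?addr0 // => j ji.
by rewrite mnm1E eq_sym (negPf ji).
Qed.

Variables (F : idomainType) (R : realDomainType) (w : 'I_n -> R).
Implicit Types (p q : {mpoly F[n]}) (d e : R).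

(** A relation, because the zero polynomial has no weighted degree; conversely, a polynomial that
    has one is nonzero. *)
Definition has_wdeg p d :=
  (forall m, m \in msupp p -> wtmnm w m <= d) /\
  (exists2 m, m \in msupp p & wtmnm w m = d).

Lemma has_wdeg_exists p : p != 0 ->
  exists2 m, m \in msupp p & has_wdeg p (wtmnm w m).
Proof.
rewrite -msupp_eq0 => p0.
have [m mp mM] := exists_seq_max (wtmnm w) p0.
by exists m => //; split=> //; exists m.
Qed.

Definition initial_form d p : {mpoly F[n]} :=
  \sum_(m <- msupp p | wtmnm w m == d) p@_m *: 'X_[m].

Lemma mcoeff_initial_form d p m :
  (initial_form d p)@_m = if wtmnm w m == d then p@_m else 0.
Proof.
rewrite /initial_form raddf_sum /=.
under eq_bigr => k _ do rewrite mcoeffZ mcoeffX.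
have [mp|mp] := boolP (m \in msupp p); last first.
  rewrite big_seq_cond big1 => [|k /andP[kp _]].
    by rewrite (memN_msupp_eq0 mp) if_same.
  by case: eqP mp => [<-|]; rewrite ?kp ?mulr0.
rewrite -big_filter; case: ifP => md.
  rewrite (bigD1_seq m) ?mem_filter ?md ?mp ?filter_uniq //= eqxx mulr1.
  by rewrite big1 ?addr0 // => k /negPf->; rewrite mulr0.
rewrite big_seq big1 // => k; rewrite mem_filter => /andP[kd _].
have km : k != m by apply: contraFneq md => <-.
by rewrite (negPf km) mulr0.
Qed.

(* The leading monomial of the product of the two initial forms survives in
   [p * q], since all other products of monomials have smaller weight. *)
Lemma has_wdegM p q d e :
  has_wdeg p d -> has_wdeg q e -> has_wdeg (p * q) (d + e).
Proof.
move=> [pd [mp mpp mpd]] [qe [mq mqq mqe]]; split.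
  move=> m /msuppM_le /allpairsP[[m1 m2] /= [m1p m2q ->]].
  by rewrite wtmnmD lerD ?pd ?qe.
have nz r x m : m \in msupp r -> wtmnm w m = x -> initial_form x r != 0.
  move=> mr mx; apply/negP => /eqP /(congr1 (mcoeff m)).
  by rewrite mcoeff_initial_form mx eqxx mcoeff0; apply/eqP;
    rewrite -mcoeff_msupp.
have supp r x m : m \in msupp (initial_form x r) ->
    m \in msupp r /\ wtmnm w m = x.
  rewrite !mcoeff_msupp mcoeff_initial_form.
  by case: ifP => [/eqP|_ /eqP].
have rest r x m : (forall m, m \in msupp r -> wtmnm w m <= x) ->
    m \in msupp (r - initial_form x r) -> wtmnm w m < x.
  move=> rx; rewrite mcoeff_msupp mcoeffB mcoeff_initial_form.
  case: ifP => [_|/negbT mx]; first by rewrite subrr eqxx.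
  by rewrite subr0 -mcoeff_msupp lt_neqAle mx => /rx.
set p0 := initial_form d p; set q0 := initial_form e q.
have pq0 : p0 * q0 != 0 by apply: mulf_neq0; [exact: nz mpp _|exact: nz mqq _].
set m := mlead (p0 * q0).
have mm : m \in msupp (p0 * q0) by apply: mlead_supp.
have mde : wtmnm w m = d + e.
  have /allpairsP[[m1 m2] /= [/supp[_ m1d] /supp[_ m2e] ->]] := msuppM_le mm.
  by rewrite wtmnmD m1d m2e.
exists m => //; rewrite mcoeff_msupp.
have -> : p * q = p0 * q0 + (p0 * (q - q0) + (p - p0) * q) by ring.
rewrite !mcoeffD; have -> : (p0 * (q - q0))@_m = 0.
  apply/eqP; rewrite mcoeff_eq0; apply/negP => /msuppM_le.
  move=> /allpairsP[[m1 m2] /= [/supp[_ m1d] /(rest _ _ _ qe) m2e mE]].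
  by move: mde m2e; rewrite mE wtmnmD m1d => /addrI ->; rewrite ltxx.
have -> : ((p - p0) * q)@_m = 0.
  apply/eqP; rewrite mcoeff_eq0; apply/negP => /msuppM_le.
  move=> /allpairsP[[m1 m2] /= [/(rest _ _ _ pd) m1d /qe m2e mE]].
  by move: mde (ltr_leD m1d m2e); rewrite mE wtmnmD => ->; rewrite ltxx.
by rewrite !addr0 -mcoeff_msupp.
Qed.

Lemma has_wdeg1 : has_wdeg 1 0.
Proof.
split=> [m|]; rewrite msupp1 ?inE; last first.
  by exists 0%MM; rewrite ?inE ?wtmnm0.
by move=> /eqP ->; rewrite wtmnm0.
Qed.

Lemma has_wdegXn p d k : has_wdeg p d -> has_wdeg (p ^+ k) (d *+ k).
Proof.
move=> pd; elim: k => [|k IH]; first exact: has_wdeg1.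
by rewrite exprS mulrS; apply: has_wdegM.
Qed.

(** Without common monomials nothing cancels, even when [d = e]. *)
Lemma has_wdegB p q d e : has_wdeg p d -> has_wdeg q e ->
  (forall m, m \in msupp p -> m \notin msupp q) ->
  has_wdeg (p - q) (Num.max d e).
Proof.
move=> [pd [mp mpp mpd]] [qe [mq mqq mqe]] pq; split.
  move=> m /msuppB_le; rewrite mem_cat le_max => /orP[/pd ->//|/qe ->].
  by rewrite orbT.
have [le|lt] := leP d e; [exists mq => //|exists mp => //].
  rewrite mcoeff_msupp mcoeffB memN_msupp_eq0 ?sub0r ?oppr_eq0;
    rewrite -?mcoeff_msupp //.
  by apply: contraL mqq => /pq.
by rewrite mcoeff_msupp mcoeffB (memN_msupp_eq0 (pq _ mpp)) subr0 -mcoeff_msupp.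
Qed.

(** A monomial of maximal weight in a term of maximal degree has to cancel against the same monomial
    in another term, whose degree is then maximal too. *)
Lemma sum_eq0_max_twice (J : eqType) (s : seq J) (f : J -> {mpoly F[n]})
    (d : J -> R) :
  uniq s -> s != [::] -> (forall j, j \in s -> has_wdeg (f j) (d j)) ->
  \sum_(j <- s) f j = 0 ->
  exists i k, [/\ i \in s, k \in s, i <> k, d i = d k &
    forall j, j \in s -> d j <= d i].
Proof.
move=> us s0 fd f0.
have [i is_ iM] := exists_seq_max d s0.
have [_ [m mi md]] := fd _ is_.
have [/hasP[k ks /andP[ki mk]]|/hasPn no] :=
    boolP (has (fun k => (k != i) && (m \in msupp (f k))) s).
  exists i, k; split=> //; first by move=> ik; rewrite ik eqxx in ki.
  apply/le_anti; rewrite iM // andbT -md.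
  by have [+ _] := fd _ ks; apply.
move: (congr1 (mcoeff m) f0); rewrite (bigD1_seq i) //= mcoeffD mcoeff0.
rewrite raddf_sum big_seq_cond big1 => [|k /andP[ks ki]]; last first.
  by apply/eqP; rewrite mcoeff_eq0; move: (no k ks); rewrite ki.
by move=> /eqP; rewrite addr0 mcoeff_eq0 mi.
Qed.

End WeightedDegree.

(** * Cross products and the conic through the six lifted points *)

Lemma I3_ind (P : 'I_3 -> Prop) : P 0 -> P 1 -> P 2 -> forall i, P i.
Proof.
move=> P0 P1 P2 i; suff : i \in ([:: 0; 1; 2] : seq 'I_3).
  by rewrite !inE => /or3P[] /eqP ->.
by case: i => [[|[|[|]]]].
Qed.

Lemma I3_addE : ((0 + 1)%R = 1%R :> 'I_3) * ((0 + 2)%R = 2%R :> 'I_3) *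
  ((1 + 1)%R = 2%R :> 'I_3) * ((1 + 2)%R = 0%R :> 'I_3) *
  ((2 + 1)%R = 0%R :> 'I_3) * ((2 + 2)%R = 1%R :> 'I_3).
Proof. by do !split; apply/val_inj. Qed.

Lemma I3_sum (i : 'I_3) : ((i + 1)%R + (i + 2)%R + i = 3)%N.
Proof. by elim/I3_ind: i. Qed.

(* The intersection of the line UX with the line joining W to the point where
   YZ meets l; the paper's A', B', C' are three instances of it. *)
Definition vertex (V : Type) (cr : V -> V -> V) (U X W Y Z l : V) : V :=
  cr (cr U X) (cr W (cr (cr Y Z) l)).

Section CrossProduct.
Variable R : comNzRingType.
Implicit Types u v w : 'I_3 -> R.

Definition dot u v : R := u 0 * v 0 + u 1 * v 1 + u 2 * v 2.

Definition cross u v : 'I_3 -> R :=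
  fun i => u (i + 1) * v (i + 2) - u (i + 2) * v (i + 1).

Lemma dot_crossl u v : dot (cross u v) u = 0.
Proof. by rewrite /dot /cross !I3_addE; ring. Qed.

Lemma dot_crossr u v : dot (cross u v) v = 0.
Proof. by rewrite /dot /cross !I3_addE; ring. Qed.

Lemma dot_cross_cross u v w z :
  dot (cross u (cross v w)) z = dot u w * dot v z - dot u v * dot w z.
Proof. by rewrite /dot /cross !I3_addE; ring. Qed.

Definition conic_exponents : seq (nat * nat) :=
  [:: (0, 0); (1, 0); (0, 1); (2, 0); (1, 1); (0, 2)]%N.

Definition monomial u (ij : nat * nat) : R :=
  u 0 ^+ ij.1 * u 1 ^+ ij.2 * u 2 ^+ (2 - ij.1 - ij.2).

Definition conic_eval (k : nat * nat -> R) u : R :=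
  \sum_(ij <- conic_exponents) k ij * monomial u ij.

(** Coefficients of the degenerate conic formed by the lines [u] and [v]. *)
Definition line_pair u v (ij : nat * nat) : R :=
  match ij with
  | (0%N, 0%N) => u 2 * v 2
  | (1%N, 0%N) => u 0 * v 2 + u 2 * v 0
  | (0%N, 1%N) => u 1 * v 2 + u 2 * v 1
  | (2%N, 0%N) => u 0 * v 0
  | (1%N, 1%N) => u 0 * v 1 + u 1 * v 0
  | (0%N, 2%N) => u 1 * v 1
  | _ => 0
  end.

Lemma conic_eval_line_pair u v w :
  conic_eval (line_pair u v) w = dot u w * dot v w.
Proof.
by rewrite /conic_eval !big_cons big_nil /monomial /line_pair /dot /=; ring.
Qed.

(* With M_i = p_i L_i - q_i l, this is the quotient by l of the cubic
   p_1 p_2 p_3 L_1 L_2 L_3 - M_1 M_2 M_3. *)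
Definition pencil_conic (L1 L2 L3 l : 'I_3 -> R) (p1 p2 p3 q1 q2 q3 : R)
    (ij : nat * nat) : R :=
  p1 * p2 * q3 * line_pair L1 L2 ij + p1 * q2 * p3 * line_pair L1 L3 ij +
  q1 * p2 * p3 * line_pair L2 L3 ij - p1 * q2 * q3 * line_pair L1 l ij -
  q1 * p2 * q3 * line_pair L2 l ij - q1 * q2 * p3 * line_pair L3 l ij +
  q1 * q2 * q3 * line_pair l l ij.

Lemma conic_eval_pencil_conic L1 L2 L3 l p1 p2 p3 q1 q2 q3 w :
  let z1 := dot L1 w in let z2 := dot L2 w in let z3 := dot L3 w in
  let y := dot l w in
  conic_eval (pencil_conic L1 L2 L3 l p1 p2 p3 q1 q2 q3) w =
  p1 * p2 * q3 * (z1 * z2) + p1 * q2 * p3 * (z1 * z3) +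
  q1 * p2 * p3 * (z2 * z3) - p1 * q2 * q3 * (z1 * y) -
  q1 * p2 * q3 * (z2 * y) - q1 * q2 * p3 * (z3 * y) + q1 * q2 * q3 * (y * y).
Proof.
rewrite /= -!conic_eval_line_pair /conic_eval !big_cons !big_nil.
by rewrite /pencil_conic; ring.
Qed.

(** By [dot_cross_cross], [cross B (cross L1 l)] is [dot B l] times [L1] minus [dot B L1] times [l],
    which gives p_1 and q_1. The pairs [C], [L2] and [A], [L3] give the other scalars. *)
Definition pascal_conic (A B C X1 X2 X3 l : 'I_3 -> R) : nat * nat -> R :=
  let L1 := cross A X1 in let L2 := cross B X2 in let L3 := cross C X3 in
  pencil_conic L1 L2 L3 l (dot B l) (dot C l) (dot A l)
    (dot B L1) (dot C L2) (dot A L3).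

(** On L_i the cubic reduces to - M_1 M_2 M_3 with M_i = - q_i l, and dividing by l leaves q_i times
    the other two M_j. As polynomial identities these also cover points on [l]. *)
Lemma pascal_conicP A B C X1 X2 X3 l (w : 'I_3 -> R) :
  let L1 := cross A X1 in let L2 := cross B X2 in let L3 := cross C X3 in
  let M1 := cross B (cross L1 l) in let M2 := cross C (cross L2 l) in
  let M3 := cross A (cross L3 l) in
  let K := conic_eval (pascal_conic A B C X1 X2 X3 l) w in
  [/\ dot L1 w = 0 -> K = dot B L1 * dot M2 w * dot M3 w,
      dot L2 w = 0 -> K = dot C L2 * dot M1 w * dot M3 w &
      dot L3 w = 0 -> K = dot A L3 * dot M1 w * dot M2 w].
Proof.
rewrite /= /pascal_conic conic_eval_pencil_conic !dot_cross_cross.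
by split=> ->; ring.
Qed.

(** Each point lies on some L_i and on some M_j with j different from i: A on L_1 and M_3, B on L_2
    and M_1, C on L_3 and M_2; A' on L_3 and M_1, B' on L_1 and M_2, C' on L_2 and M_3. *)
Lemma pascal_conic_vanishes A B C X1 X2 X3 l :
  let K := conic_eval (pascal_conic A B C X1 X2 X3 l) in
  [/\ K A = 0, K B = 0 & K C = 0] /\
  [/\ K (vertex cross C X3 B A X1 l) = 0, K (vertex cross A X1 C B X2 l) = 0 &
      K (vertex cross B X2 A C X3 l) = 0].
Proof.
move=> K; have KP w := pascal_conicP A B C X1 X2 X3 l w; rewrite /= in KP.
have dotC u v : dot u v = dot v u by rewrite /dot; ring.
have c0 u v : dot u (cross u v) = 0 by rewrite dotC dot_crossl.
have c1 u v : dot v (cross u v) = 0 by rewrite dotC dot_crossr.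
split; split.
- by have [E _ _] := KP A; rewrite /K E ?dot_crossl ?mulr0.
- by have [_ E _] := KP B; rewrite /K E ?dot_crossl ?mulr0 ?mul0r.
- by have [_ _ E] := KP C; rewrite /K E ?dot_crossl ?mulr0 ?mul0r.
- have [_ _ E] := KP (vertex cross C X3 B A X1 l).
  by rewrite /K E /vertex ?c0 ?c1 ?mulr0 ?mul0r.
- have [E _ _] := KP (vertex cross A X1 C B X2 l).
  by rewrite /K E /vertex ?c0 ?c1 ?mulr0 ?mul0r.
- have [_ E _] := KP (vertex cross B X2 A C X3 l).
  by rewrite /K E /vertex ?c0 ?c1 ?mulr0 ?mul0r.
Qed.

End CrossProduct.

Arguments cross {R} u v _.

(** * Ring morphisms, for evaluating the conic at integer vectors *)

Section Morphism.
Variables (R S : comNzRingType) (f : {rmorphism R -> S}).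
Implicit Types u v : 'I_3 -> R.

Lemma rmorph_dot u v : f (dot u v) = dot (f \o u) (f \o v).
Proof. by rewrite /dot !rmorphD !rmorphM. Qed.

Lemma rmorph_cross u v : f \o cross u v = cross (f \o u) (f \o v).
Proof. by apply: funext => i; rewrite /= /cross rmorphB !rmorphM. Qed.

Lemma rmorph_line_pair u v ij :
  f (line_pair u v ij) = line_pair (f \o u) (f \o v) ij.
Proof.
rewrite /line_pair /=; move: (u 0) (u 1) (u 2) (v 0) (v 1) (v 2) => *.
by case: ij => [[|[|[|?]]] [|[|[|?]]]]; rewrite ?rmorphD ?rmorphM ?rmorph0.
Qed.

Lemma rmorph_pencil_conic (L1 L2 L3 l : 'I_3 -> R) p1 p2 p3 q1 q2 q3 ij :
  f (pencil_conic L1 L2 L3 l p1 p2 p3 q1 q2 q3 ij) =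
  pencil_conic (f \o L1) (f \o L2) (f \o L3) (f \o l)
    (f p1) (f p2) (f p3) (f q1) (f q2) (f q3) ij.
Proof.
rewrite /pencil_conic -!rmorph_line_pair.
move: (line_pair L1 L2 ij) (line_pair L1 L3 ij) (line_pair L2 L3 ij).
move: (line_pair L1 l ij) (line_pair L2 l ij) (line_pair L3 l ij).
by move: (line_pair l l ij) => *; rewrite !(rmorphD, rmorphN, rmorphM).
Qed.

Lemma rmorph_pascal_conic (A B C X1 X2 X3 l : 'I_3 -> R) ij :
  f (pascal_conic A B C X1 X2 X3 l ij) =
  pascal_conic (f \o A) (f \o B) (f \o C) (f \o X1) (f \o X2) (f \o X3)
    (f \o l) ij.
Proof.
by rewrite /pascal_conic rmorph_pencil_conic !rmorph_dot !rmorph_cross.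
Qed.

End Morphism.

(** * Lifting tropical vectors to vectors of polynomials *)

Definition trop_cross (R : realDomainType) (s t : 'I_3 -> R) : 'I_3 -> R :=
  fun i => Num.max (s (i + 1) + t (i + 2)) (s (i + 2) + t (i + 1)).

Arguments trop_cross {R} s t _.

Definition on_trop_conic (R : realDomainType) (a : nat * nat -> R)
    (t : 'I_3 -> R) : Prop :=
  let term ij :=
    a ij + (t 0 *+ ij.1 + t 1 *+ ij.2 + t 2 *+ (2 - ij.1 - ij.2)) in
  exists i j, [/\ i \in conic_exponents, j \in conic_exponents, i <> j,
    term i = term j & forall ij, ij \in conic_exponents -> term ij <= term i].

Section Lifting.
Import mpoly.
Variables (R : realDomainType) (I : finType).

Let n := #|{: I * 'I_3}|.
Let poly := {mpoly int[n]}.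

Definition indet (k : I) (i : 'I_3) : poly := 'X_(enum_rank (k, i)).

Variables (h : I -> 'I_3 -> R) (sgn : I -> int).

Let w (j : 'I_n) : R := h (enum_val j).1 (enum_val j).2.

(* The torus (x_0, x_1, x_2) |-> (x_0, z x_1, z^2 x_2) acts on points, and
   inversely on lines; this is the degree in z. *)
Let grade (j : 'I_n) : int := sgn (enum_val j).1 * (enum_val j).2%:Z.

(** [D] lists the inputs whose indeterminates may occur; [s] is the slope of the grade as a function
    of the coordinate, of opposite signs for points and lines. The last two clauses are what rules
    out cancellation in cross products. *)
Definition lifts (D : seq I) (s : int) (u : 'I_3 -> poly) (t : 'I_3 -> R) :=
  [/\ forall i, has_wdeg w (u i) (t i),
      forall i m j, m \in msupp (u i) -> m j != 0%N -> (enum_val j).1 \in D &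
      exists c, forall i m, m \in msupp (u i) ->
        wtmnm grade m = c + s * i%:Z].

Lemma lifts_indet k : lifts [:: k] (sgn k) (indet k) (h k).
Proof.
split=> [i|i m j|].
- rewrite /has_wdeg /indet msuppX; split=> [m|].
    by rewrite inE => /eqP ->; rewrite wtmnm1 /w enum_rankK.
  by exists U_(enum_rank (k, i))%MM; rewrite ?inE // wtmnm1 /w enum_rankK.
- rewrite msuppX !inE => /eqP ->; rewrite mnm1E eqb0 negbK => /eqP <-.
  by rewrite enum_rankK.
- exists 0 => i m; rewrite msuppX inE => /eqP ->.
  by rewrite wtmnm1 /grade enum_rankK add0r.
Qed.

(* The two terms of each coordinate of the cross product have no monomial in
   common: such a monomial would have the same factor in the indeterminates
   of [u], whereas distinct coordinates of [u] have distinct grades. *)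
Lemma lifts_cross D D' s u v t t' :
  lifts D s u t -> lifts D' s v t' -> s != 0 -> ~~ has (mem D) D' ->
  lifts (D ++ D') (- s) (cross u v) (trop_cross t t').
Proof.
move=> [ut uD [c uc]] [vt vD [c' vc]] s0 disj; split.
- move=> i; apply: has_wdegB; try exact: has_wdegM.
  move=> m /msuppM_le /allpairsP[[m1 m2] /= [m1u m2v mE]].
  apply/negP => /msuppM_le /allpairsP[[m1' m2'] /= [m1u' m2v' mE']].
  have m1E : m1 = m1'.
    apply/mnmP => j; move: mE'; rewrite mE => /mnmP /(_ j); rewrite !mnmDE.
    have [jD|jD] := boolP ((enum_val j).1 \in D).
      have v0 i' m' : m' \in msupp (v i') -> m' j = 0%N.
        move=> m'v; apply/eqP; apply: contraNT disj => /(vD _ _ _ m'v) jD'.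
        by apply/hasP; exists (enum_val j).1.
      by rewrite (v0 _ _ m2v) (v0 _ _ m2v') !addn0.
    have u0 i' m' : m' \in msupp (u i') -> m' j = 0%N.
      by move=> m'u; apply/eqP; apply: contraNT jD => /(uD _ _ _ m'u).
    by rewrite (u0 _ _ m1u) (u0 _ _ m1u').
  have := uc _ _ m1u; rewrite m1E (uc _ _ m1u') => /addrI /(mulfI s0).
  by elim/I3_ind: i {m1u m2v m1u' m2v'}; rewrite !I3_addE.
- move=> i m j; rewrite mem_cat => /msuppB_le; rewrite mem_cat => mM.
  suff [i1 [i2 [m1 [m2 [m1u m2v ->]]]]] : exists i1 i2 m1 m2,
      [/\ m1 \in msupp (u i1), m2 \in msupp (v i2) & m = (m1 + m2)%MM].
    rewrite mnmDE addn_eq0 negb_and => /orP[/(uD _ _ _ m1u) ->//|].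
    by move=> /(vD _ _ _ m2v) ->; rewrite orbT.
  case/orP: mM => /msuppM_le /allpairsP[[m1 m2] /= [m1u m2v mE]].
    by exists (i + 1), (i + 2), m1, m2.
  by exists (i + 2), (i + 1), m1, m2.
(* The representatives of [i], [i + 1], [i + 2] add up to 3, so both products have grade c + c' + s
   (3 - i), and the slope changes sign. *)
- exists (c + c' + s * Posz 3) => i m /msuppB_le; rewrite mem_cat.
  case/orP => /msuppM_le /allpairsP[[m1 m2] /= [m1u m2v ->]];
    rewrite wtmnmD (uc _ _ m1u) (vc _ _ m2v) mulNr;
    rewrite -(congr1 Posz (I3_sum i)) !PoszD;
    ring.
Qed.

(** One disjointness condition for each of the five cross products; the slope alternates between [s]
    and [- s] as points and lines alternate. *)
Lemma lifts_vertex DU DX DW DY DZ Dl s U X W Y Z l tU tX tW tY tZ tl :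
  lifts DU s U tU -> lifts DX s X tX -> lifts DW s W tW -> lifts DY s Y tY ->
  lifts DZ s Z tZ -> lifts Dl (- s) l tl -> s != 0 ->
  ~~ has (mem DU) DX -> ~~ has (mem DY) DZ -> ~~ has (mem (DY ++ DZ)) Dl ->
  ~~ has (mem DW) (DY ++ DZ ++ Dl) ->
  ~~ has (mem (DU ++ DX)) (DW ++ DY ++ DZ ++ Dl) ->
  lifts (DU ++ DX ++ DW ++ DY ++ DZ ++ Dl) s
    (vertex cross U X W Y Z l) (vertex trop_cross tU tX tW tY tZ tl).
Proof.
move=> lU lX lW lY lZ ll s0 d1 d2 d3 d4 d5.
have s0' : - s != 0 by rewrite oppr_eq0.
have l1 := lifts_cross lY lZ s0 d2.
have l2 := lifts_cross l1 ll s0' d3; rewrite opprK -catA in l2.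
have l3 := lifts_cross lW l2 s0 d4.
have := lifts_cross (lifts_cross lU lX s0 d1) l3 s0' d5.
by rewrite opprK -catA.
Qed.

(** Weighted degrees are additive on products, so the terms of the vanishing sum have the tropical
    terms as their degrees, and [sum_eq0_max_twice] applies. *)
Lemma lifts_conic_eval (k : nat * nat -> poly) (a : nat * nat -> R) D s u t :
  lifts D s u t ->
  (forall ij, ij \in conic_exponents -> has_wdeg w (k ij) (a ij)) ->
  conic_eval k u = 0 ->
  on_trop_conic a t.
Proof.
move=> [ut _ _] ka ku; apply: sum_eq0_max_twice ku => // ij ijJ.
by apply: has_wdegM (ka _ ijJ) _; do 2?apply: has_wdegM; apply: has_wdegXn.
Qed.

(** The degree is the weight of a monomial, hence a sum of entries of [h]. *)
Lemma has_wdeg_closed (T : R -> Prop) (p : poly) :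
  T 0 -> (forall x y, T x -> T y -> T (x + y)) -> (forall k i, T (h k i)) ->
  p != 0 -> exists2 d, has_wdeg w p d & T d.
Proof.
move=> T0 TD Th p0; have [m _ pm] := has_wdeg_exists w p0.
exists (wtmnm w m) => //; rewrite /wtmnm; elim/big_ind: _ => // j _.
by elim: (m j) => [|k IH]; rewrite ?mulr0n // mulrS; apply: TD => //; apply: Th.
Qed.

Lemma meval_neq0 (f : I -> 'I_3 -> int) (p : poly) :
  p.@[fun j => f (enum_val j).1 (enum_val j).2] != 0 -> p != 0.
Proof. by apply: contra => /eqP ->; rewrite meval0. Qed.

End Lifting.

(** * The theorem in homogeneous tropical coordinates *)

Section HomogeneousPascal.
Import mpoly.

(** Nonvanishing guarantees that the coefficients have weighted degrees. A single integer
    specialization at which all six are nonzero proves it. *)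
Lemma pascal_conic_indet_neq0 (x := fun k lt => indet (@Ordinal 7 k lt)) ij :
  ij \in conic_exponents ->
  pascal_conic (x 0 isT) (x 1 isT) (x 2 isT) (x 3 isT) (x 4 isT) (x 5 isT)
    (x 6 isT) ij != 0.
Proof.
(* Values of [A], [B], [C], [X1], [X2], [X3], [l], in this order. *)
pose s : seq (seq int) := [:: [:: 1; 1; 0]; [:: 0; 1; 1]; [:: 1; 0; 1];
  [:: 0; 1; 0]; [:: 1; 0; 0]; [:: 1; 0; 0]; [:: 1; 1; 0]].
pose y (k : 'I_7) (i : 'I_3) := nth 0 (nth [::] s k) i.
move=> ijJ; apply: (@meval_neq0 _ y); rewrite rmorph_pascal_conic.
have xE k lt : meval (fun j => y (enum_val j).1 (enum_val j).2) \o x k lt =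
    y (Ordinal lt).
  by apply: funext => i; rewrite /= mevalXU enum_rankK.
rewrite !xE.
move: ij ijJ; apply/allP.
by vm_compute.
Qed.

Lemma trop_pascal (R : realDomainType) (T : R -> Prop)
    (A B C X1 X2 X3 l : 'I_3 -> R) :
  T 0 -> (forall x y, T x -> T y -> T (x + y)) ->
  (forall i, [/\ T (A i), T (B i) & T (C i)]) ->
  (forall i, [/\ T (X1 i), T (X2 i), T (X3 i) & T (l i)]) ->
  exists2 a : nat * nat -> R,
    forall ij, ij \in conic_exponents -> T (a ij) &
    [/\ on_trop_conic a A, on_trop_conic a B & on_trop_conic a C] /\
    [/\ on_trop_conic a (vertex trop_cross C X3 B A X1 l),
        on_trop_conic a (vertex trop_cross A X1 C B X2 l) &
        on_trop_conic a (vertex trop_cross B X2 A C X3 l)].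
Proof.
move=> T0 TD TP TX.
pose h (k : 'I_7) := nth A [:: A; B; C; X1; X2; X3; l] k.
(* Input 6 is the line [l]; the others are points. *)
pose sgn (k : 'I_7) : int := if k == 6 :> nat then -1 else 1.
have Th k i : T (h k i).
  have [? ? ?] := TP i; have [? ? ? ?] := TX i.
  by case: k => [[|[|[|[|[|[|[|k]]]]]]]].
pose x k (lt : (k < 7)%N) := indet (Ordinal lt).
pose K := pascal_conic (x 0 isT) (x 1 isT) (x 2 isT) (x 3 isT) (x 4 isT)
  (x 5 isT) (x 6 isT).
have [a aK] : exists a : nat * nat -> R, forall ij, ij \in conic_exponents ->
    has_wdeg (fun j => h (enum_val j).1 (enum_val j).2) (K ij) (a ij) /\
    T (a ij).
  suff /choice[a aK] : forall ij, exists d, ij \in conic_exponents ->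
      has_wdeg (fun j => h (enum_val j).1 (enum_val j).2) (K ij) d /\ T d.
    by exists a.
  move=> ij; have [/pascal_conic_indet_neq0 K0|_] := boolP (ij \in _).
    by have [d Kd Td] := has_wdeg_closed T0 TD Th K0; exists d.
  (* A default: outside [conic_exponents] the coefficient of [K] is zero and has no weighted
     degree. *)
  by exists 0.
exists a => [ij /aK[]//|].
have lx k lt : lifts h sgn [:: @Ordinal 7 k lt] (sgn (Ordinal lt)) (x k lt)
  (h (Ordinal lt)) by apply: lifts_indet.
have onK D u t : lifts h sgn D 1 u t -> conic_eval K u = 0 -> on_trop_conic a t.
  by move=> ut; apply: lifts_conic_eval ut _ => ij /aK[].
have [[KA KB KC] [KA' KB' KC']] := pascal_conic_vanishes (x 0 isT) (x 1 isT)
  (x 2 isT) (x 3 isT) (x 4 isT) (x 5 isT) (x 6 isT).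
split; split.
- exact: onK (lx 0 isT) KA.
- exact: onK (lx 1 isT) KB.
- exact: onK (lx 2 isT) KC.
(* The six inputs entering a vertex are distinct, so the disjointness conditions hold by
   computation. *)
- by apply: onK KA'; apply: (lifts_vertex (lx 2 isT) (lx 5 isT) (lx 1 isT)
    (lx 0 isT) (lx 3 isT) (lx 6 isT)).
- by apply: onK KB'; apply: (lifts_vertex (lx 0 isT) (lx 3 isT) (lx 2 isT)
    (lx 1 isT) (lx 4 isT) (lx 6 isT)).
- by apply: onK KC'; apply: (lifts_vertex (lx 1 isT) (lx 4 isT) (lx 0 isT)
    (lx 2 isT) (lx 5 isT) (lx 6 isT)).
Qed.

End HomogeneousPascal.

(* The value group is closed under the group operations *)
From mathcomp Require Import classical_sets reals constructive_ereal.
Local Open Scope classical_set_scope.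

Section ValueGroup.
Variables (R : realType) (K : fieldType) (v : K -> \bar R).
Hypothesis vK : rank_one_valuation v.

Lemma value_group0 : value_group v 0.
Proof.
exists 1; have := valuationM vK 1 1; rewrite mulr1.
have := valuation_ninfty vK (x := 1).
have := (valuation_pinfty vK 1).1.
case: (v 1) => [r _ _ [rr]|/(_ erefl)/eqP|_ //]; last by rewrite oner_eq0.
by congr (_%:E); lra.
Qed.

Lemma value_groupD s t :
  value_group v s -> value_group v t -> value_group v (s + t).
Proof.
by move=> [x xs] [y yt]; exists (x * y); rewrite (valuationM vK) xs yt.
Qed.

Lemma value_groupN s : value_group v s -> value_group v (- s).
Proof.
(* The factor [e] of value 0 stands in for 1: the product of [x] and [x^-1 * e] is [e]. *)
move=> [x xs]; have [e e0] := value_group0; exists (x^-1 * e).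
have x0 : x != 0.
  by apply/eqP => /(valuation_pinfty vK x).2; rewrite xs.
have := valuationM vK x (x^-1 * e); rewrite mulrA divff // mul1r e0 xs.
by case: (v _) => // r [rE]; congr (_%:E); lra.
Qed.

End ValueGroup.

(** * Stable constructions in homogeneous coordinates *)

Section StableConstructions.
Variable R : realType.
Implicit Types (T : set R) (q r : R * R) (a b l : coeffs R).

(** The third coordinate is 0, the tropical unit. *)
Definition point_coords q (i : 'I_3) : R := nth 0 [:: q.1; q.2; 0] i.

Definition line_coords a (i : 'I_3) : R :=
  nth 0 [:: a (1, 0); a (0, 1); a (0, 0)] i.

Lemma line_coords_stable_line q r :
  line_coords (stable_line q r) =
  trop_cross (point_coords q) (point_coords r).
Proof.
apply: funext => i; elim/I3_ind: i; rewrite /trop_cross !I3_addE /=.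
- by rewrite /line_coords /point_coords /= addr0 add0r.
- by rewrite /line_coords /point_coords /= addr0 add0r maxC.
- by [].
Qed.

Lemma point_coords_stable_intersection a b :
  point_coords (stable_intersection a b) =
  fun i => trop_cross (line_coords a) (line_coords b) i -
           trop_cross (line_coords a) (line_coords b) 2.
Proof.
apply: funext => i; elim/I3_ind: i; rewrite /trop_cross !I3_addE.
- rewrite /line_coords /point_coords /=.
  by rewrite [b (0, 1) + _]addrC [b (1, 0) + _]addrC.
- rewrite /line_coords /point_coords /=.
  by rewrite maxC [b (1, 0) + a (0, 0)]addrC [b (1, 0) + a (0, 1)]addrC.
- by rewrite subrr.
Qed.

Lemma trop_cross_shift (s t : 'I_3 -> R) c :
  trop_cross s (fun i => t i + c) = fun i => trop_cross s t i + c.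
Proof.
by apply: funext => i; rewrite /trop_cross !addrA addr_maxl.
Qed.

Definition stable_vertex U X W Y Z l :=
  stable_intersection (stable_line U X)
    (stable_line W (stable_intersection (stable_line Y Z) l)).

Lemma stable_intersectionC a b :
  stable_intersection a b = stable_intersection b a.
Proof.
rewrite /stable_intersection /=.
by congr (_ - _, _ - _); rewrite maxC.
Qed.

(** By [trop_cross_shift], normalizing the inner intersection point shifts the final vector by a
    constant, which the outer normalization cancels; [c] is the third coordinate of the unnormalized
    vertex. *)
Lemma vertex_point_coords U X W Y Z l : exists c,
  vertex trop_cross (point_coords U) (point_coords X) (point_coords W)
    (point_coords Y) (point_coords Z) (line_coords l) =
  fun i => point_coords (stable_vertex U X W Y Z l) i + c.
Proof.
rewrite /stable_vertex /vertex.
rewrite point_coords_stable_intersection !line_coords_stable_line.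
rewrite point_coords_stable_intersection !line_coords_stable_line.
rewrite !trop_cross_shift; set s := trop_cross _ (trop_cross _ _).
by exists (s 2); apply: funext => i; ring.
Qed.

Lemma conic_supportP ij : conic_support ij ->
  exists2 kl, kl \in conic_exponents & ij = (kl.1%:Z, kl.2%:Z).
Proof.
case: ij => [[i|i] [j|j]] [//= _ _ ij2]; exists (i, j) => //.
by move: ij2; case: i j => [|[|[|i]]] [|[|[|j]]].
Qed.

(** Shifting the homogeneous coordinates by [c] raises all terms by 2c, so their comparison is
    unaffected. Absolute values turn the integer exponents, nonnegative on the support, into
    naturals. *)
Lemma on_trop_conic_curve T (a : nat * nat -> R) q (t : 'I_3 -> R) c :
  (T `*` T) q -> t = (fun i => point_coords q i + c) -> on_trop_conic a t ->
  tropical_curve T conic_support (fun ij => a (`|ij.1|, `|ij.2|)%N) q.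
Proof.
move=> Tq -> [i [j [iJ jJ ij eij maxi]]]; split=> //.
pose b : coeffs R := fun ij => a (`|ij.1|, `|ij.2|)%N.
have termE kl : kl \in conic_exponents ->
    a kl + ((point_coords q 0 + c) *+ kl.1 + (point_coords q 1 + c) *+ kl.2 +
      (point_coords q 2 + c) *+ (2 - kl.1 - kl.2)) =
    tropical_term b (kl.1%:Z, kl.2%:Z) q + c *+ 2.
  rewrite /tropical_term /b /point_coords -!pmulrn /= add0r => klJ.
  (* The truncated subtraction is exact on [conic_exponents], so the three exponents add up to 2. *)
  have -> : c *+ 2 = c *+ kl.1 + c *+ kl.2 + c *+ (2 - kl.1 - kl.2).
    rewrite -!mulrnDr; congr (_ *+ _).
    by apply/eqP; move: kl klJ; apply/allP.
  by rewrite !mulrnDl; case: kl {klJ} => *; ring.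
have inS kl : kl \in conic_exponents -> conic_support (kl.1%:Z, kl.2%:Z).
  by rewrite !inE; do 5?[case/orP]; move=> /eqP ->.
exists (i.1%:Z, i.2%:Z), (j.1%:Z, j.2%:Z); split; try exact: inS.
- by move=> [e1 e2]; apply: ij; case: i j e1 e2 {iJ jJ eij maxi} =>
    [? ?] [? ?] /= -> ->.
- by move: eij; rewrite !termE // => /addIr.
- move=> mn /conic_supportP[kl klJ ->].
  by have := maxi _ klJ; rewrite !termE // lerD2r.
Qed.

Lemma stable_line_in T q r :
  (forall x y, T x -> T y -> T (x + y)) -> (T `*` T) q -> (T `*` T) r ->
  tropical_line_coeffs T (stable_line q r).
Proof.
move=> TD [Tq1 Tq2] [Tr1 Tr2] ij.
have Tmax x y : T x -> T y -> T (Num.max x y) by move=> Tx Ty; case: leP.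
rewrite /line_support /= !inE => /or3P[] /eqP ->; apply: Tmax => //;
  exact: TD.
Qed.

Lemma stable_intersection_in T a b :
  (forall x y, T x -> T y -> T (x + y)) -> (forall x, T x -> T (- x)) ->
  tropical_line_coeffs T a -> tropical_line_coeffs T b ->
  (T `*` T) (stable_intersection a b).
Proof.
move=> TD TN Ta Tb.
have Tmax x y : T x -> T y -> T (Num.max x y) by move=> Tx Ty; case: leP.
have [Ta0 Ta1 Ta2] : [/\ T (a (0, 0)), T (a (1, 0)) & T (a (0, 1))].
  by split; apply: Ta; rewrite /line_support /= !inE.
have [Tb0 Tb1 Tb2] : [/\ T (b (0, 0)), T (b (1, 0)) & T (b (0, 1))].
  by split; apply: Tb; rewrite /line_support /= !inE.
by split; apply: (TD _ _ _ (TN _ _)); apply: Tmax; apply: TD.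
Qed.

End StableConstructions.

Theorem theorem47 (R : realType) (K : closedFieldType) (v : K -> \bar R)
    (T : set R) (A B C X1 X2 X3 : R * R) (l : coeffs R) :
  rank_one_valuation v ->
  T = value_group v ->
  (forall s : rat, T (ratr s)) ->
  (T `*` T) A -> (T `*` T) B -> (T `*` T) C ->
  (T `*` T) X1 -> (T `*` T) X2 -> (T `*` T) X3 ->
  tropical_line_coeffs T l ->
  let L_AB' := stable_line A X1 in
  let L_BC' := stable_line B X2 in
  let L_CA' := stable_line C X3 in
  let P := stable_intersection L_AB' l in
  let Q := stable_intersection L_BC' l in
  let S := stable_intersection L_CA' l in
  let L_AC' := stable_line A S in
  let L_BA' := stable_line B P in
  let L_CB' := stable_line C Q in
  let A' := stable_intersection L_CA' L_BA' in
  let B' := stable_intersection L_AB' L_CB' in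
  let C' := stable_intersection L_AC' L_BC' in
  exists2 D : set (R * R), is_tropical_conic T D &
    [set` [:: A; B; C; A'; B'; C']] `<=` D.
Proof.
move=> vK TE _ TA TB TC TX1 TX2 TX3 Tl.
move=> L_AB' L_BC' L_CA' P Q S L_AC' L_BA' L_CB' A' B' C'.
have T0 : T 0 by rewrite TE; apply: value_group0.
have TD x y : T x -> T y -> T (x + y) by rewrite TE; apply: value_groupD.
have TN x : T x -> T (- x) by rewrite TE; apply: value_groupN.
have Tline q r : (T `*` T) q -> (T `*` T) r ->
    tropical_line_coeffs T (stable_line q r) by apply: stable_line_in.
have Tint a b : tropical_line_coeffs T a -> tropical_line_coeffs T b ->
    (T `*` T) (stable_intersection a b) by apply: stable_intersection_in.
have Tpoint q i : (T `*` T) q -> T (point_coords q i).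
  by move=> [Tq1 Tq2]; elim/I3_ind: i.
have Tlc i : T (line_coords l i).
  by elim/I3_ind: i; apply: Tl; rewrite /line_support /= !inE.
have [a Ta [[aA aB aC] [aA' aB' aC']]] := @trop_pascal R T (point_coords A)
  (point_coords B) (point_coords C) (point_coords X1) (point_coords X2)
  (point_coords X3) (line_coords l) T0 TD
  (fun i => And3 (Tpoint _ i TA) (Tpoint _ i TB) (Tpoint _ i TC))
  (fun i => And4 (Tpoint _ i TX1) (Tpoint _ i TX2) (Tpoint _ i TX3) (Tlc i)).
exists (tropical_curve T conic_support (fun ij => a (`|ij.1|, `|ij.2|)%N)).
  by eexists; last reflexivity; move=> ij /conic_supportP[kl klJ ->]; apply: Ta.
have on_point q : (T `*` T) q -> on_trop_conic a (point_coords q) ->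
    tropical_curve T conic_support (fun ij => a (`|ij.1|, `|ij.2|)%N) q.
  move=> Tq; apply: (on_trop_conic_curve (c := 0)) => //.
  by apply: funext => i; rewrite addr0.
have on_vertex U X W Y Z : (T `*` T) U -> (T `*` T) X -> (T `*` T) W ->
    (T `*` T) Y -> (T `*` T) Z ->
    on_trop_conic a (vertex trop_cross (point_coords U) (point_coords X)
      (point_coords W) (point_coords Y) (point_coords Z) (line_coords l)) ->
    tropical_curve T conic_support (fun ij => a (`|ij.1|, `|ij.2|)%N)
      (stable_vertex U X W Y Z l).
  move=> TU TX TW TY TZ; have [c ->] := vertex_point_coords U X W Y Z l.
  apply: on_trop_conic_curve => //; apply: (Tint _ _ (Tline _ _ TU TX)).
  exact: (Tline _ _ TW (Tint _ _ (Tline _ _ TY TZ) Tl)).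
move=> q; rewrite /= !inE; do 5?[case/orP]; move=> /eqP ->.
- exact: on_point.
- exact: on_point.
- exact: on_point.
- exact: (on_vertex _ _ _ _ _ TC TX3 TB TA TX1 aA').
- exact: (on_vertex _ _ _ _ _ TA TX1 TC TB TX2 aB').
(* In [vertex] the line through [U] and [X] comes first, which here is [L_BC']. *)
- rewrite /C' stable_intersectionC.
  exact: (on_vertex _ _ _ _ _ TB TX2 TA TC TX3 aC').
Qed.
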